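(* Let $P_r$ denote the path on $r$ vertices. For any integers $r\geq 4$ and $n\geq 2r$, $$\mathrm{sat_p}(P_r,P_r[n])=\begin{cases}\left(\frac r2-1\right)n^2+(r-2)n+3-r, & \text{if } r \text{ is even},\\[2pt] \left(\frac r2-\frac12\right)n^2+(r-4)n+5-r, & \text{if } r\text{ is odd}.\end{cases}$$
   Context: For a graph $H$ and $n\in\mathbb{N}$, $H[n]$ is the graph obtained from $H$ by replacing each vertex with an independent set (a part) of size $n$ and each edge with a complete bipartite graph between the corresponding parts. A copy of $H$ in $H[n]$ is partite if it has exactly one vertex in each part of $H[n]$. A spanning subgraph $G\subseteq H[n]$ is $H$-partite-free if it contains no partite copy of $H$. $G$ is $(H,H[n])$-partite-saturated if $G$ is $H$-partite-free but for every edge $uv\in E(H[n])\setminus E(G)$ the graph $G\cup uv$ contains a partite copy of $H$. $\mathrm{sat_p}(H,H[n])$ is the minimum of $e(G)$ over all $(H,H[n])$-partite-saturated graphs $G$. *)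

(* Defs.v *)
From mathcomp Require Import all_boot all_order all_algebra.

Set Implicit Arguments.
Unset Strict Implicit.
Unset Printing Implicit Defensive.

Record sgraph (T : finType) := SGraph {
  adj :> rel T;
  adj_sym : symmetric adj;
  adj_irr : irreflexive adj }.

Definition edges (T : finType) (G : sgraph T) : {set {set T}} :=
  [set [set p.1; p.2] | p : T * T & G p.1 p.2].

Definition num_edges (T : finType) (G : sgraph T) : nat := #|edges G|.

Definition subgraph (T : finType) (G K : sgraph T) : Prop :=
  forall x y, G x y -> K x y.

Section AddEdge.
Variables (T : finType) (G : sgraph T) (u v : T).

(* The conjunct [x != y] only matters for [u = v], where nothing is added. *)
Definition add_edge_rel : rel T := fun x y =>
  G x y || ((x != y) && (((x == u) && (y == v)) || ((x == v) && (y == u)))).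

Fact add_edge_sym : symmetric add_edge_rel.
Proof.
move=> x y; rewrite /add_edge_rel (adj_sym G) (eq_sym x y); congr (_ || (_ && _)).
by rewrite orbC; congr (_ || _); rewrite andbC.
Qed.

Fact add_edge_irr : irreflexive add_edge_rel.
Proof. by move=> x; rewrite /add_edge_rel (adj_irr G) eqxx. Qed.

Definition add_edge : sgraph T := SGraph add_edge_sym add_edge_irr.
End AddEdge.

Section Blowup.
Variables (T : finType) (H : sgraph T) (n : nat).

(* [(x, i)] is the [i]-th vertex of the part replacing the vertex [x] of [H]. *)
Definition blowup_rel : rel (T * 'I_n) := fun a b => H a.1 b.1.

Fact blowup_sym : symmetric blowup_rel.
Proof. by move=> a b; apply: adj_sym. Qed.

Fact blowup_irr : irreflexive blowup_rel.
Proof. by move=> a; apply: adj_irr. Qed.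

Definition blowup : sgraph (T * 'I_n)%type := SGraph blowup_sym blowup_irr.

(* A copy of [H] need not place the vertex [x] of [H] in the part of [x]. *)
Definition has_partite_copy (G : sgraph (T * 'I_n)%type) : Prop :=
  exists f : T -> T * 'I_n,
    [/\ injective f,
        forall x y, H x y -> G (f x) (f y)
      & forall z : T, exists! x : T, (f x).1 = z].

Definition partite_saturated (G : sgraph (T * 'I_n)%type) : Prop :=
  [/\ subgraph G blowup,
      ~ has_partite_copy G
    & forall u v, blowup u v -> ~~ G u v -> has_partite_copy (add_edge G u v)].

(* [m] is the minimum defining sat_p(H, H[n]). It is a relation because for
   edgeless [H] there is no saturated graph to minimise over. *)
Definition is_satp (m : nat) : Prop :=
  (exists2 G, partite_saturated G & num_edges G = m) /\
  (forall G, partite_saturated G -> m <= num_edges G).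
End Blowup.

Section PathGraph.
Variable r : nat.

Definition path_rel : rel 'I_r := fun i j => (i.+1 == j :> nat) || (j.+1 == i :> nat).

Fact path_rel_sym : symmetric path_rel.
Proof. by move=> i j; rewrite /path_rel orbC. Qed.

Fact path_rel_irr : irreflexive path_rel.
Proof. by move=> i; rewrite /path_rel orbb eqn_leq ltnn. Qed.

Definition path_graph : sgraph 'I_r := SGraph path_rel_sym path_rel_irr.
End PathGraph.

(* Main.v *)
Require Import Defs.
From mathcomp Require Import all_boot all_order all_algebra.
From mathcomp Require Import zify ring.
Set Implicit Arguments.
Unset Strict Implicit.
Unset Printing Implicit Defensive.
Import Order.TTheory GRing.Theory Num.Theory.

(** Write k = r - 1 and number the parts of the blow-up of the path from 0 to k.
An injective walk along a path never turns back, so a partite copy of the path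
is, up to reversal, a choice of one vertex per part with consecutive choices
adjacent: a crossing from part 0 to part k ([partite_copyP]).

Let A_i be the set of vertices of part i reachable from part 0 by moving
forward. In a saturated graph the non-edges between parts i and i+1 are exactly
the pairs in A_i x (V_(i+1) \ A_(i+1)) ([linkE]): an edge leaving A_i ends in
A_(i+1), while a missing edge uv would complete a crossing, so u is reachable
and v leads on to part k, hence is not reachable. A saturated graph is thus
described by the sizes a_i = |A_i|, and has

    k n^2 - sum_(i < k) a_i (n - a_(i+1))

edges. The sizes satisfy a_0 = n and a_k = 0; once they reach 0 they stay
there, and, dually, a value n can only be preceded by n ([reached_profile]).
Every sequence that runs from n to 0 with intermediate values strictly between
0 and n occurs, for the graph in which A_i consists of the first a_i vertices of
part i ([threshold_saturated]).

What remains is to maximise sum_(i < k) a_i (n - a_(i+1)). Peeling off terms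
from the left, the best sum starting from a given a_0 < n is bounded by an
affine function of a_0, whose slope is n - 1 or 1 according to the parity of the
number of remaining terms ([missing_le_lt]); the induction step reduces to
(a_0 - 1)(a_1 - 1) >= 0 or (n - 1 - a_0)(n - 1 - a_1) >= 0. Sequences alternating
between 1 and n - 1 make these equalities. The first term, with a_0 = n, is then
optimised separately and gives a_1 = 1 for both parities ([missing_le],
[missing_extremal]). *)

(** * Maximising the number of missing edges over size profiles *)

Section Profiles.
Local Open Scope ring_scope.
Variable n : int.
Hypothesis n_ge2 : 2 <= n.
Implicit Types (k : nat) (a : nat -> int).

(** The constraints on the sizes of the reachable sets of a saturated graph. *)
Definition profile k a : Prop :=
  [/\ forall i, (i <= k)%N -> 0 <= a i <= n,
      forall i, (i < k)%N -> a i = 0 -> a i.+1 = 0,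
      forall i, (i < k)%N -> a i.+1 = n -> a i = n
    & a k = 0].

(** If a i vertices of layer i are reachable, then a i * (n - a i.+1) pairs are
missing between layers i and i+1. *)
Definition missing k a : int := \sum_(i < k) a i * (n - a i.+1).

Let d : int := (n - 1) ^+ 2 + 1.

Lemma missingS k a :
  missing k.+1 a = a 0%N * (n - a 1%N) + missing k (fun i => a i.+1).
Proof. by rewrite /missing big_ord_recl. Qed.

Lemma profileS k a : profile k.+1 a -> profile k (fun i => a i.+1).
Proof.
move=> [bnd zero full last]; split=> // i hi; [exact: bnd | exact: zero | exact: full].
Qed.

Lemma missing_from0 k a : profile k a -> a 0%N = 0 -> missing k a = 0.
Proof.
elim: k a => [|k IH] a pa a0; first by rewrite /missing big_ord0.
have [_ zero _ _] := pa.
by rewrite missingS a0 mul0r add0r IH ?zero //; apply: profileS.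
Qed.

(** Peeling off the first term a_0 (n - a_1) reduces the odd case to
(a_0 - 1) (a_1 - 1) >= 0, which fails for a_1 = 0; but then the remaining terms
all vanish. The even case reduces to (n - 1 - a_0) (n - 1 - a_1) >= 0. *)
Lemma missing_le_lt k a : profile k a -> a 0%N < n ->
  missing k a <= if odd k then a 0%N * (n - 1) + (n - 1) + (k./2)%:Z * d
                 else a 0%N + (n - 2) + (k./2)%:Z * d.
Proof.
elim: k a => [|k IH] a pa a0n.
  by case: (pa) => _ _ _ a0; rewrite /missing big_ord0 /= a0; lia.
have [bnd zero full last] := pa.
have x_ge0 : 0 <= a 0%N by case/andP: (bnd 0%N isT).
have [y_ge0 y_len] : 0 <= a 1%N /\ a 1%N <= n by apply/andP; apply: bnd.
have y_ltn : a 1%N < n.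
  by rewrite lt_neqAle y_len andbT; apply: contraTneq a0n => /full -> //; rewrite ltxx.
have := IH _ (profileS pa) y_ltn; rewrite missingS /= uphalf_half.
have d_ge0 : 0 <= (k./2)%:Z * d by rewrite mulr_ge0 // /d; nia.
have [y0|y_neq0] := eqVneq (a 1%N) 0.
  rewrite (missing_from0 (profileS pa)) //= y0 => _.
  by case: (odd k); rewrite /= ?add0n ?PoszD ?mulrDl /d; nia.
have x_neq0 : a 0%N != 0 by apply: contraNneq y_neq0 => /zero ->.
by case: (odd k); rewrite /= ?add0n ?PoszD ?mulrDl /d; nia.
Qed.

(** The maximum of [missing k] over the profiles starting at n, for k > 2. *)
Definition max_missing k : int :=
  if odd k then n ^+ 2 - 1 + (k./2)%:Z * d else n ^+ 2 + n - 2 + (k./2.-1)%:Z * d.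

(** For k = 1 the only profile is (n, 0), with n^2 missing pairs: one more than
the general formula. The induction on k serves the profiles that start with n
repeated, whose first term is zero; otherwise the tail obeys
[missing_le_lt]. *)
Lemma missing_le k a : (0 < k)%N -> profile k a -> a 0%N = n ->
  missing k a <= max_missing k + (k == 1%N)%:Z.
Proof.
elim: k a => // k IH a _ pa a0.
have [bnd zero full last] := pa.
have [y_ge0 y_len] : 0 <= a 1%N /\ a 1%N <= n by apply/andP; apply: bnd.
case: k => [|k] in IH pa bnd zero full last *.
  by rewrite missingS /missing big_ord0 a0 last /max_missing /=; lia.
rewrite missingS a0 addr0.
have d_ge : n - 1 <= d by rewrite /d; nia.
have d_ge0 j : 0 <= j%:Z * d by rewrite mulr_ge0 //; lia.
have [yn|y_neqn] := eqVneq (a 1%N) n.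
  have := IH _ isT (profileS pa) yn.
  rewrite yn subrr mulr0 add0r => /le_trans; apply.
  rewrite /max_missing /= uphalf_half eqSS.
  case: k {IH pa bnd zero full last} => [|k] /=; first by lia.
  by case: (odd k); rewrite /= ?add1n ?add0n /= ?intS ?mulrDl; lia.
have y_ltn : a 1%N < n by rewrite lt_neqAle y_neqn.
have [y0|y_neq0] := eqVneq (a 1%N) 0.
  rewrite (missing_from0 (profileS pa)) //= y0.
  rewrite /max_missing /= ?uphalf_half.
  have := d_ge0 (k./2); case: (odd k); rewrite /= ?add1n ?add0n /= ?intS ?mulrDl; nia.
have := missing_le_lt (profileS pa) y_ltn.
rewrite /max_missing /= ?uphalf_half.
case: (odd k); rewrite /= ?add1n ?add0n /= ?intS ?mulrDl /=; nia.
Qed.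

(** Equality in the induction step of [missing_le_lt] requires a_1 = 1 or
a_1 = n - 1, according to the parity of the distance to the end. *)
Definition alternate k i : int :=
  if i == k then 0 else if odd (k - i) then n - 1 else 1.

Lemma missing_alternate k : (0 < k)%N ->
  missing k (alternate k) =
    if odd k then (n - 1) * (n - 1) + (n - 1) + (k./2)%:Z * d
    else 1 + (n - 2) + (k./2)%:Z * d.
Proof.
elim: k => // k IH _; rewrite missingS.
case: k IH => [_|k /(_ isT)].
  by rewrite /missing big_ord0 /alternate /=; ring.
move=> E.
transitivity ((if ~~ odd k.+1 then n - 1 else 1) *
  (n - (if odd k.+1 then n - 1 else 1)) +
  missing k.+1 (alternate k.+1)); first by rewrite /alternate subn0.
rewrite E /= ?uphalf_half.
by case: (odd k); rewrite /= ?add1n ?add0n ?intS /d; ring.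
Qed.

(** Starting from n the best next value is 1 whatever the parity of k, which
breaks the alternation when k is even: n, 1, 1, n - 1, 1, n - 1, .., 0. *)
Definition extremal k i : int :=
  match i with 0 => n | 1 => 1 | i'.+2 => alternate (k - 2) i' end%N.

Lemma extremal_last k : (1 < k)%N -> extremal k k = 0.
Proof. by case: k => [|[|k]] // _; rewrite /extremal /alternate subn2 eqxx. Qed.

Lemma extremal_gt0 k i : (i < k)%N -> 0 < extremal k i.
Proof.
case: i => [|[|i]] /= ik; [lia | by [] | rewrite /alternate].
have -> : (i == k - 2)%N = false by lia.
by case: ifP => _; lia.
Qed.

Lemma extremal_lt k i : (0 < i)%N -> extremal k i < n.
Proof.
case: i => [|[|i]] /= i_gt0; [by [] | lia | rewrite /alternate].
by case: ifP => _; [|case: ifP => _]; lia.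
Qed.

Lemma extremal_ge0_le k i : (1 < k)%N -> (i <= k)%N -> 0 <= extremal k i <= n.
Proof.
move=> k_gt1; rewrite leq_eqVlt => /orP[/eqP ->|ik]; first by rewrite extremal_last //=; lia.
rewrite ltW ?extremal_gt0 //=; case: i ik => [|i] _; first by rewrite /=.
by rewrite ltW // extremal_lt.
Qed.

Lemma missing_extremal k : (2 < k)%N -> missing k (extremal k) = max_missing k.
Proof.
case: k => [|[|[|k]]] // _; rewrite 2!missingS.
have -> : missing k.+1 (fun i => extremal k.+3 i.+2) = missing k.+1 (alternate k.+1).
  by rewrite /extremal subn2.
rewrite missing_alternate // /max_missing /= /alternate /=.
rewrite ?uphalf_half; case: (odd k); rewrite /= ?add1n ?add0n ?intS /d; ring.
Qed.

End Profiles.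

(** * Partite copies of a path and counting edges by layers *)

(** Without immediate backtracking the direction of the first step persists. *)
Lemma walk_shift k (s : nat -> nat) :
    (forall i, i < k -> s i.+1 = (s i).+1 \/ s i = (s i.+1).+1) ->
    (forall i, i.+2 <= k -> s i.+2 <> s i) ->
  (forall i, i <= k -> s i = s 0 + i) \/ (forall i, i <= k -> s 0 = s i + i).
Proof.
move=> step noback; case: k step noback => [|k] step noback.
  by left=> i; rewrite leqn0 => /eqP ->; rewrite addn0.
case: (step 0 isT) => s1; [left | right].
- suff H i : i <= k -> s i = s 0 + i /\ s i.+1 = s 0 + i.+1.
    by case=> [|i] hi; [rewrite addn0 | case: (H i hi)].
  elim: i => [|i IH] hi; first by rewrite addn0 addn1.
  have [e1 e2] := IH (ltnW hi); split=> //.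
  by have := step i.+1 hi; have := noback i hi; lia.
- suff H i : i <= k -> s 0 = s i + i /\ s 0 = s i.+1 + i.+1.
    by case=> [|i] hi; [rewrite addn0 | case: (H i hi)].
  elim: i => [|i IH] hi; first by rewrite addn0 addn1.
  have [e1 e2] := IH (ltnW hi); split=> //.
  by have := step i.+1 hi; have := noback i hi; lia.
Qed.

Lemma add_edgeC (T : finType) (H : sgraph T) x y : add_edge H x y =2 add_edge H y x.
Proof. by move=> z t; rewrite /= /add_edge_rel [X in _ && X]orbC. Qed.

Section Layers.
Variables (k n : nat).
Local Notation vertex := ('I_k.+1 * 'I_n)%type.
Local Notation P := (path_graph k.+1).
Implicit Types (G : sgraph vertex) (u v : 'I_n) (w : nat -> 'I_n).

(** The layers are indexed by all natural numbers, so that consecutive layers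
need no bound proofs. *)
Definition link G i u v : bool := G (inord i, u) (inord i.+1, v).

Definition crossing (E : nat -> rel 'I_n) : Prop :=
  exists w, forall i, i < k -> E i (w i) (w i.+1).

(** The parts visited by a copy form a walk in the path without repetition, so
[walk_shift] and the bounds 0 and k leave only the identity and the reversal. *)
Lemma partite_copyP G : subgraph G (blowup P n) ->
  has_partite_copy P G <-> crossing (link G).
Proof.
move=> subG; split; last first.
  move=> [w hw]; exists (fun i : 'I_k.+1 => (i, w i)); split.
  - by move=> i j [].
  - have dir (i j : 'I_k.+1) : i.+1 = j -> G (i, w i) (j, w j).
      move=> ij; have ik : i < k by rewrite -ltnS ij.
      by have := hw _ ik; rewrite /link inord_val ij inord_val.
    by move=> i j /orP[] /eqP; [|rewrite adj_sym]; apply: dir.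
  - by move=> z; exists z; split=> //= j ->.
move=> [f [finj fG fpart]].
have part_inj (i j : 'I_k.+1) : (f i).1 = (f j).1 -> i = j.
  by move=> e; have [x [_ ux]] := fpart (f i).1; rewrite -(ux i) // -(ux j).
have fG1 i : i < k -> G (f (inord i)) (f (inord i.+1)).
  by move=> ik; apply: fG; rewrite /= /path_rel !inordK ?eqxx //; lia.
pose s i : nat := (f (inord i)).1.
have s_lt i : s i <= k by rewrite -ltnS; apply: ltn_ord.
have step i : i < k -> s i.+1 = (s i).+1 \/ s i = (s i.+1).+1.
  by move=> ik; case/orP: (subG _ _ (fG1 i ik)) => /eqP; rewrite /s => <-; [left|right].
have noback i : i.+2 <= k -> s i.+2 <> s i.
  move=> ik /val_inj/part_inj/(congr1 val); rewrite /= !inordK; lia.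
have [up|down] := walk_shift step noback.
(* s 0 + k = s k <= k forces s 0 = 0 *)
- have s0 i : i <= k -> s i = i.
    by move=> ik; have := up k (leqnn k); have := up i ik; have := s_lt k; lia.
  have fE i : i <= k -> (inord i, (f (inord i)).2) = f (inord i).
    move=> ik; rewrite [RHS]surjective_pairing; congr pair.
    by apply: val_inj; rewrite /= inordK ?ltnS //; apply/esym/s0.
  exists (fun i => (f (inord i)).2) => i ik.
  by rewrite /link !fE ?fG1 // ltnW.
(* s 0 = s k + k forces s 0 = k: the copy is traversed backwards *)
- have s0 i : i <= k -> s (k - i) = i.
    move=> ik; have := down k (leqnn k); have := down (k - i) (leq_subr _ _).
    by have := s_lt 0; lia.
  have fE i : i <= k -> (inord i, (f (inord (k - i))).2) = f (inord (k - i)).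
    move=> ik; rewrite [RHS]surjective_pairing; congr pair.
    by apply: val_inj; rewrite /= inordK ?ltnS //; apply/esym/s0.
  exists (fun i => (f (inord (k - i))).2) => i ik.
  rewrite /link !fE // 1?ltnW // adj_sym.
  by rewrite -(subnSK ik) fG1 //; lia.
Qed.

(** Every edge joins consecutive layers, and orienting it forwards makes its
description by a layer and two positions unique. *)
Lemma card_edges G : subgraph G (blowup P n) ->
  num_edges G = \sum_(i < k) #|[set p : 'I_n * 'I_n | link G i p.1 p.2]|.
Proof.
move=> subG.
pose h (q : 'I_k * ('I_n * 'I_n)) : {set vertex} :=
  [set (inord q.1, q.2.1); (inord q.1.+1, q.2.2)].
pose Q := [set q : 'I_k * ('I_n * 'I_n) | link G q.1 q.2.1 q.2.2].
have -> : num_edges G = #|h @: Q|.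
  rewrite /num_edges; apply: eq_card => e.
  have dir (x y : vertex) : x.1.+1 = y.1 -> G x y -> [set x; y] \in h @: Q.
    move=> xy gxy; have xk : x.1 < k by rewrite -ltnS xy.
    have ex : x = (inord x.1, x.2) by rewrite inord_val -surjective_pairing.
    have ey : y = (inord x.1.+1, y.2) by rewrite xy inord_val -surjective_pairing.
    apply/imsetP; exists (Ordinal xk, (x.2, y.2)); first by rewrite inE /link /= -ex -ey.
    by rewrite /h /= -ex -ey.
  apply/imsetP/idP => [[[x y]]|/imsetP[q]].
  - rewrite inE /= => gxy ->.
    case/orP: (subG _ _ gxy) => /= /eqP xy; first exact: dir.
    by rewrite setUC dir // adj_sym.
  - rewrite inE => gq ->.
    by exists ((inord q.1, q.2.1), (inord q.1.+1, q.2.2)); rewrite // inE.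
rewrite card_in_imset => [|[i [u v]] [i' [u' v']] _ _].
  under [RHS]eq_bigr => i _ do rewrite -sum1_card.
  rewrite pair_big_dep -sum1_card; apply: eq_bigl => q.
  by rewrite !inE.
rewrite /h /= => e.
have m1 : ((inord i', u') : vertex) \in [set (inord i, u); (inord i.+1, v)].
  by rewrite e set21.
have m2 : ((inord i, u) : vertex) \in [set (inord i', u'); (inord i'.+1, v')].
  by rewrite -e set21.
have m3 : ((inord i.+1, v) : vertex) \in [set (inord i', u'); (inord i'.+1, v')].
  by rewrite -e set22.
move: m1 m2 m3; rewrite !inE !xpair_eqE -!val_eqE /=.
have [hi hi'] := (ltn_ord i, ltn_ord i').
rewrite !inordK ?ltnS // 1?ltnW // !(inj_eq val_inj) => h1 h2 h3.
case/orP: h2 => /andP[/eqP ii /eqP uu]; last by case/orP: h1 => /andP[/eqP ? _]; lia.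
case/orP: h3 => /andP[/eqP i1 /eqP vv]; first by move: i1; rewrite ii => /esym/n_Sn.
by rewrite uu vv ii.
Qed.

(** * Saturated graphs are determined by their reachable sets *)

(** The crossing created by a new edge must use it, as there was none before. *)
Lemma link_saturated G i u v : partite_saturated P G -> i < k -> ~~ link G i u v ->
  exists w, [/\ w i = u, w i.+1 = v &
    forall j, j < k -> j != i -> link G j (w j) (w j.+1)].
Proof.
move=> [subG free sat] ik nuv.
have buv : blowup P n (inord i, u) (inord i.+1, v).
  by rewrite /= /path_rel /= !inordK ?eqxx // ltnS // ltnW.
have subA : subgraph (add_edge G (inord i, u) (inord i.+1, v)) (blowup P n).
  move=> x y /orP[/subG //|/andP[_ /orP[]/andP[/eqP-> /eqP->]]] //.
  by rewrite adj_sym.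
have /(partite_copyP subA)[w hw] := sat _ _ buv nuv.
have new j : j < k -> link G j (w j) (w j.+1) \/ [/\ j = i, w j = u & w j.+1 = v].
  move=> jk; have /orP[|/andP[_]] := hw j jk; first by left.
  rewrite !xpair_eqE -!val_eqE /= !inordK ?ltnS // 1?ltnW // !(inj_eq val_inj).
  case/orP=> /andP[/andP[ji /eqP wj]/andP[ji1 /eqP wj1]].
    by right; split=> //; apply/eqP.
  by lia.
exists w.
have [|/negbTE wi] := boolP (link G i (w i) (w i.+1)); last first.
  have [|[_ -> ->]] := new i ik; first by rewrite wi.
  by split=> // j jk ji; have [|[/eqP]] := new j jk; rewrite // (negbTE ji).
move=> wi; case: free; apply/(partite_copyP subG); exists w => j jk.
by have [|[->]] := new j jk.
Qed.

Fixpoint reached G i : {set 'I_n} :=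
  if i is j.+1 then [set v | [exists u in reached G j, link G j u v]] else setT.

Lemma reachedS G i v :
  v \in reached G i.+1 -> exists2 u, u \in reached G i & link G i u v.
Proof. by rewrite inE => /existsP[u /andP[]]; exists u. Qed.

Lemma reached_crossing G i v : v \in reached G i ->
  exists w, w i = v /\ forall j, j < i -> link G j (w j) (w j.+1).
Proof.
elim: i v => [|i IH] v; first by exists (fun=> v).
move=> /reachedS[u /IH[w [wi wP]] uv].
exists (fun j => if j <= i then w j else v); rewrite ltnn; split=> // j.
rewrite ltnS => ji; rewrite ji; case: (ltngtP j i) ji => // [ji _|-> _]; first exact: wP.
by rewrite wi.
Qed.

Lemma crossing_reached G i w :
  (forall j, j < i -> link G j (w j) (w j.+1)) -> w i \in reached G i.
Proof.
elim: i => [|i IH] wP; first by rewrite inE.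
rewrite inE; apply/existsP; exists (w i); rewrite wP // andbT.
by apply: IH => j ji; apply: wP; apply: ltnW.
Qed.

Lemma link_reached G i u v : u \in reached G i -> link G i u v -> v \in reached G i.+1.
Proof. by move=> ur uv; rewrite inE; apply/existsP; exists u; rewrite ur. Qed.

(** Otherwise a path from layer 0 to [w i] followed by the rest of [w] would be a
crossing. *)
Lemma suffix_unreached G i w : partite_saturated P G -> i <= k ->
    (forall j, i <= j -> j < k -> link G j (w j) (w j.+1)) ->
  w i \notin reached G i.
Proof.
move=> [subG free _] ik wP; apply/negP => /reached_crossing[w' [wi' w'P]].
case: free; apply/(partite_copyP subG); exists (fun j => if j < i then w' j else w j).
move=> j jk; have [ji|ij] := ltnP j i; last by rewrite ltnNge ltnW ?ltnS //= wP.
have [j1i|ij1] := ltnP j.+1 i; first exact: w'P.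
have e : j.+1 = i by lia.
by rewrite e -wi' -e w'P.
Qed.

(** A missing link from u to v is completed to a crossing by adding it: the part
of the crossing before u shows that u is reached, the part after v that v is
not. *)
Lemma linkE G i u v : partite_saturated P G -> i < k ->
  link G i u v = ~~ ((u \in reached G i) && (v \notin reached G i.+1)).
Proof.
move=> satG ik; apply/idP/idP => [uv|].
  by case: (boolP (u \in _)) => //= /link_reached/(_ uv) ->.
apply: contraR => /(link_saturated satG ik)[w [<- <- wP]].
rewrite crossing_reached => [|j ji]; last by apply: wP; lia.
by apply: suffix_unreached => // j ij jk; apply: wP; lia.
Qed.

(** Stated for any sets that describe the links as in [linkE], so that it serves
both the reachable sets of a saturated graph and the sets from which the
extremal graph is built. *)
Lemma card_edges_layered G (A : nat -> {set 'I_n}) : subgraph G (blowup P n) ->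
    (forall i u v, i < k -> link G i u v = ~~ ((u \in A i) && (v \notin A i.+1))) ->
  ((num_edges G)%:Z = k%:Z * n%:Z ^+ 2 - missing n k (fun i => #|A i|%:Z))%R.
Proof.
move=> subG AP; rewrite (card_edges subG) /missing.
rewrite (big_morph Posz PoszD (erefl _)).
have -> : (k%:Z * n%:Z ^+ 2 = \sum_(i < k) n%:Z ^+ 2)%R.
  by rewrite sumr_const card_ord -[RHS]mulr_natl natz.
rewrite -sumrB; apply: eq_bigr => i _.
have -> : [set p : 'I_n * 'I_n | link G i p.1 p.2] = ~: setX (A i) (~: A i.+1).
  by apply/setP => -[u v]; rewrite !inE AP.
have := cardsC (setX (A i) (~: A i.+1)); have := cardsC (A i.+1).
rewrite cardsX card_prod !card_ord.
move: #|~: setX _ _| #|~: A _| #|A i| #|A _| => m c x y yc mc.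
have -> : (m%:Z = n%:Z ^+ 2 - x%:Z * c%:Z)%R by rewrite expr2 -!PoszM -mc PoszD addrC addKr.
by have -> : (c%:Z = n%:Z - y%:Z)%R by rewrite -yc PoszD addrC addKr.
Qed.

(** The least obvious constraint is that a fully reached layer i+1 is preceded by
a fully reached layer i. If u in layer i were not reached, it would be linked to
no reached x of layer i-1, and the crossing created by the edge xu would
continue to the last layer from a vertex of layer i+1, which is reached; this
contradicts [suffix_unreached]. *)
Lemma reached_profile G : 0 < n -> 0 < k -> partite_saturated P G ->
  profile n k (fun i => #|reached G i|%:Z)%R.
Proof.
move=> n_gt0 k_gt0 satG; split.
- by move=> i _; rewrite /= lez_nat -[X in (_ <= X)%N]card_ord max_card.
- move=> i _ /eqP; rewrite eqz_nat cards_eq0 => /eqP r0.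
  apply/eqP; rewrite eqz_nat cards_eq0; apply/eqP/setP => v.
  by rewrite [RHS]inE; apply/negP => /reachedS[u]; rewrite r0 inE.
- move=> i ik [c]; have fullE : #|reached G i.+1| = n := c.
  clear c.
  have full v : v \in reached G i.+1.
    suff -> : reached G i.+1 = setT by rewrite inE.
    by apply/eqP; rewrite eqEcard subsetT cardsT card_ord fullE leqnn.
  suff -> : reached G i = setT by rewrite cardsT card_ord.
  apply/setP => u; rewrite [RHS]inE; apply/negPn/negP => nu.
  case: i => [|i] in ik fullE full nu *; first by rewrite inE in nu.
  have [z /reachedS[x xr _] _] := reachedS (full u).
  have : ~~ link G i x u by rewrite linkE ?xr ?nu // ltnW.
  case/(link_saturated satG (ltnW ik)) => w [_ _ wP].
  have := @suffix_unreached G i.+2 w satG ik; rewrite full => /(_ _)/negP.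
  by case=> // j ij jk; apply: wP; lia.
- apply/eqP; rewrite eqz_nat cards_eq0; apply/eqP/setP => v; rewrite [RHS]inE.
  apply/negbTE; apply: (@suffix_unreached G k (fun=> v)) => // j kj jk; lia.
Qed.

(** * Graphs with prescribed reachable sets *)

Section Construction.
Variable a : nat -> nat.

(** The first a i vertices of part i are the intended reachable set, so an edge
is left out exactly when it leads out of these sets. *)
Definition threshold_step : rel vertex := fun x y =>
  (x.1.+1 == y.1 :> nat) && ~~ ((x.2 < a x.1) && (a y.1 <= y.2)).

Definition threshold_rel : rel vertex := fun x y =>
  threshold_step x y || threshold_step y x.

Fact threshold_sym : symmetric threshold_rel.
Proof. by move=> x y; rewrite /threshold_rel orbC. Qed.

Fact threshold_irr : irreflexive threshold_rel.
Proof. by move=> x; rewrite /threshold_rel /threshold_step orbb eqn_leq ltnn. Qed.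

Definition threshold_graph : sgraph vertex := SGraph threshold_sym threshold_irr.

Lemma link_threshold i u v : i < k ->
  link threshold_graph i u v = ~~ ((u < a i) && (a i.+1 <= v)).
Proof.
move=> ik; rewrite /link /= /threshold_rel /threshold_step /=.
have [i_lt i1_lt] : i < k.+1 /\ i.+1 < k.+1 by rewrite ltnS ltnW.
rewrite !inordK // eqxx (_ : (i.+2 == i) = false) ?orbF //.
by lia.
Qed.

Lemma threshold_subgraph : subgraph threshold_graph (blowup P n).
Proof. by move=> x y /orP[]/andP[xy _]; rewrite /= /path_rel xy ?orbT. Qed.

(** A missing edge xy has x below the threshold of its part and y above that of
the next part. The crossing that it creates uses position 0, which is below
every threshold but the last, before x, and position n - 1, which is above every
threshold but the first, after y. *)
Lemma threshold_saturated : a 0 = n -> a k = 0 -> 0 < n ->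
    (forall i, i < k -> 0 < a i) -> (forall i, 0 < i -> i <= k -> a i < n) ->
  partite_saturated P threshold_graph.
Proof.
move=> a0 ak n_gt0 pos ltan; split; first exact: threshold_subgraph.
  move/(partite_copyP threshold_subgraph) => [w wP].
  (* a crossing starts below the threshold and can never get above it *)
  suff H i : i <= k -> w i < a i by have := H k (leqnn k); rewrite ak.
  elim: i => [|i IH] ik; first by rewrite a0.
  by have := wP i ik; rewrite link_threshold // (IH (ltnW ik)) /= -ltnNge.
have fwd (x y : vertex) : x.1.+1 = y.1 -> ~~ threshold_graph x y ->
    has_partite_copy P (add_edge threshold_graph x y).
  move=> xy nxy.
  have xk : x.1 < k by rewrite -ltnS xy.
  have ex : x = (inord x.1, x.2) by rewrite inord_val -surjective_pairing.
  have ey : y = (inord x.1.+1, y.2) by rewrite xy inord_val -surjective_pairing.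
  have : ~~ link threshold_graph x.1 x.2 y.2 by rewrite /link -ex -ey.
  rewrite link_threshold // negbK => /andP[xa ay].
  have subA : subgraph (add_edge threshold_graph x y) (blowup P n).
    move=> z t /orP[/threshold_subgraph //|/andP[_ /orP[]/andP[/eqP-> /eqP->]]] /=;
    by rewrite /path_rel xy eqxx ?orbT.
  apply/(partite_copyP subA).
  have old i u v : link threshold_graph i u v -> link (add_edge threshold_graph x y) i u v.
    by move=> uv; apply/orP; left.
  pose lo : 'I_n := Ordinal n_gt0; pose hi : 'I_n := rev_ord lo.
  exists (fun i => if i < x.1 then lo else if i == x.1 then x.2 else
                   if i == x.1.+1 then y.2 else hi) => i ik.
  case: (ltngtP i x.1) => [ix|ix|->].
  - apply: old; rewrite link_threshold // negb_and; apply/orP; right; rewrite -ltnNge.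
    case: (ltngtP i.+1 x.1) => [ix1|ix1|->] //=.
    + by apply: pos; lia.
    + by lia.
  - apply: old; rewrite link_threshold // negb_and; apply/orP; left; rewrite -leqNgt.
    case: eqP => [->|_] //=; rewrite subn1 -ltnS prednK //.
    by apply: ltan; lia.
  - rewrite ltnNge leqnSn /= gtn_eqF // eqxx -ex -ey.
    rewrite /link /= /add_edge_rel !eqxx /= andbT; apply/orP; right.
    by apply/eqP => exy; move: xy; rewrite exy => /eqP; rewrite gtn_eqF.
move=> x y /orP[]/eqP xy nxy; first exact: fwd.
have [|f [finj fG fpart]] := fwd _ _ xy; first by rewrite adj_sym.
by exists f; split=> // z t /fG; rewrite add_edgeC.
Qed.

End Construction.
End Layers.

(** * The saturation number *)

Local Open Scope ring_scope.

Lemma threshold_extremal (k n : nat) (a := fun i => `|extremal n k i|%N) :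
    (2 < k)%N -> (2 <= n)%N ->
  partite_saturated (path_graph k.+1) (threshold_graph k n a) /\
  (num_edges (threshold_graph k n a))%:Z = k%:Z * n%:Z ^+ 2 - max_missing n k.
Proof.
move=> k_gt2 n_ge2; have k_gt1 := ltnW k_gt2.
have n_ge2Z : 2 <= n%:Z by [].
have aE i : (i <= k)%N -> (a i)%:Z = extremal n k i.
  by move=> ik; rewrite /a gez0_abs //; case/andP: (extremal_ge0_le n_ge2Z k_gt1 ik).
split.
  apply: threshold_saturated => //.
  - by rewrite /a extremal_last.
  - exact: ltnW.
  - by move=> i ik; rewrite -ltz_nat aE ?extremal_gt0 // ltnW.
  - by move=> i i_gt0 ik; rewrite -ltz_nat aE ?extremal_lt.
have -> := @card_edges_layered k n _ (fun i => [set v : 'I_n | (v < a i)%N])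
  (@threshold_subgraph k n a).
  congr (_ - _); rewrite -missing_extremal //; apply: eq_bigr => -[i ik] _ /=.
  have cardA j : (j <= k)%N -> #|[set v : 'I_n | (v < a j)%N]|%:Z = extremal n k j.
    move=> jk; rewrite -aE //; congr Posz.
    have aj : (a j <= n)%N.
      by rewrite -lez_nat aE //; case/andP: (extremal_ge0_le n_ge2Z k_gt1 jk).
    rewrite -sum1dep_card -(big_ord_widen n (fun=> 1%N) aj).
    by rewrite sum1_card card_ord.
  by rewrite !cardA // ltnW.
by move=> i u v ik; rewrite link_threshold // !inE -leqNgt.
Qed.

Lemma saturated_edges_ge (k n : nat) (G : sgraph ('I_k.+1 * 'I_n)%type) :
    (2 < k)%N -> (2 <= n)%N -> partite_saturated (path_graph k.+1) G ->
  k%:Z * n%:Z ^+ 2 - max_missing n k <= (num_edges G)%:Z.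
Proof.
move=> k_gt2 n_ge2 satG; have [subG _ _] := satG.
rewrite (card_edges_layered subG (A := reached G)); last first.
  by move=> i u v ik; apply: linkE.
rewrite lerD2l lerN2.
have := @missing_le n n_ge2 k _ (ltnW (ltnW k_gt2))
  (reached_profile (ltnW n_ge2) (ltnW (ltnW k_gt2)) satG).
by rewrite /= cardsT card_ord gtn_eqF ?addr0 //; last exact: ltnW; apply.
Qed.

Theorem theorem11 (r n : nat) (hr : (4 <= r)%N) (hn : (2 * r <= n)%N) :
  exists2 m : nat, is_satp (path_graph r) n m &
    (m%:R : rat) =
      if odd r
      then (r%:R / 2%:R - 1 / 2%:R) * n%:R ^+ 2 + (r%:R - 4%:R) * n%:R + 5%:R - r%:R
      else (r%:R / 2%:R - 1) * n%:R ^+ 2 + (r%:R - 2%:R) * n%:R + 3%:R - r%:R.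
Proof.
case: r hr hn => // k k_gt2 hn; have n_ge2 : (2 <= n)%N by lia.
have [satG eG] := threshold_extremal k_gt2 n_ge2.
exists (num_edges (threshold_graph k n (fun i => `|extremal n k i|%N))).
  split; first by eexists; first exact: satG.
  by move=> G /(saturated_edges_ge k_gt2 n_ge2); rewrite -eG lez_nat.
rewrite -natz in eG; move/(congr1 (fun z : int => z%:~R : rat)): eG.
rewrite natz rmorphB rmorphM rmorphXn /= -!pmulrn => ->.
rewrite /max_missing.
have := odd_double_half k; move: (k./2) => j.
case: (odd k) => /= kE; rewrite -kE -mul2n.
  rewrite -natr1 natrD natrM.
  rewrite !(rmorphD, rmorphB, rmorphM, rmorphXn, rmorph1) /= -!pmulrn.
  by field.
case: j kE => [|j _]; first by lia.
rewrite add0n -natr1 natrM -[(j.+1)%:R]natr1 [j.+1.-1]/=.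
rewrite !(rmorphD, rmorphB, rmorphM, rmorphXn, rmorph1) /= -!pmulrn.
by field.
Qed.
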